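(* For every integer $n\ge 1$, the cover pebbling number of the complete graph $K_n$ on $n$ vertices is $\gamma(K_n)=2n-1$.
   Context: All graphs are finite and connected. A configuration of pebbles on a graph $G$ assigns a nonnegative integer number of pebbles to each vertex; its size is the total number of pebbles. A pebbling move consists of taking two pebbles off of one vertex (which must have at least two) and placing one pebble on an adjacent vertex. The cover pebbling number $\gamma(G)$ is the minimum number $k$ such that from every initial configuration with $k$ pebbles there is a (possibly empty) sequence of pebbling moves after which every vertex of $G$ simultaneously has at least one pebble on it. *)

(* Defs.v *)
From Stdlib Require Import Relations.
From mathcomp Require Import all_boot.

Set Implicit Arguments.
Unset Strict Implicit.
Unset Printing Implicit Defensive.

Record cgraph := CGraph {
  vertex :> finType;
  adj : rel vertex;
  adj_sym : symmetric adj;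
  adj_irr : irreflexive adj;
  adj_conn : forall x y : vertex, connect adj x y
}.

Definition config (G : cgraph) := {ffun G -> nat}.

Definition config_size (G : cgraph) (c : config G) : nat := \sum_(v : G) c v.

(* The truncated subtraction is exact in [pebbling_move], which requires
   [2 <= c u]; there [u != v] since adjacency is irreflexive. *)
Definition move_along (G : cgraph) (u v : G) (c : config G) : config G :=
  [ffun w => if w == u then c w - 2 else if w == v then c w + 1 else c w].

Definition pebbling_move (G : cgraph) (c c' : config G) : Prop :=
  exists u v : G, [/\ adj u v, 2 <= c u & c' = move_along u v c].

Definition cover_solvable (G : cgraph) (c : config G) : Prop :=
  exists c' : config G,
    clos_refl_trans (config G) (@pebbling_move G) c c' /\
    forall v : G, 1 <= c' v.

Definition always_cover_solvable (G : cgraph) (k : nat) : Prop :=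
  forall c : config G, config_size c = k -> cover_solvable c.

(* The minimum is a relation rather than a function: asserting it for [k]
   includes the existence of the minimum; [k] is then unique. *)
Definition is_cover_pebbling_number (G : cgraph) (k : nat) : Prop :=
  always_cover_solvable G k /\
  forall j : nat, always_cover_solvable G j -> k <= j.

Definition complete_adj (n : nat) : rel 'I_n := fun x y => x != y.

Lemma complete_adj_sym n : symmetric (@complete_adj n).
Proof. by move=> x y; rewrite /complete_adj eq_sym. Qed.

Lemma complete_adj_irr n : irreflexive (@complete_adj n).
Proof. by move=> x; rewrite /complete_adj eqxx. Qed.

Lemma complete_adj_conn n (x y : 'I_n) : connect (@complete_adj n) x y.
Proof. by have [->|nxy] := eqVneq x y; [exact: connect0 | exact: connect1]. Qed.

Definition complete_graph (n : nat) : cgraph :=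
  CGraph (@complete_adj_sym n) (@complete_adj_irr n) (@complete_adj_conn n).

(* Main.v *)
Require Import Defs.
From Stdlib Require Import Relations.
From mathcomp Require Import all_boot zify.

Set Implicit Arguments.
Unset Strict Implicit.
Unset Printing Implicit Defensive.

(* Lower bound: weigh the pebbles on a root [r] by 1 and all other pebbles by 2.
   No move increases the total weight; a covering configuration weighs at least
   2n - 1, while k pebbles stacked on [r] weigh k.
   Upper bound: a vertex with c >= 1 pebbles can afford floor((c - 1) / 2) moves
   while staying covered.  With 2n - 1 pebbles these spare moves add up to at
   least the number of empty vertices, and each one covers an empty vertex. *)

(** Isolates the two vertices that a move touches. With [sum_move_along], comparing any vertexwise
    sum before and after a move reduces to arithmetic at [u] and [v]. *)
Lemma sum_config_split (G : cgraph) (F : G -> nat -> nat) (u v : G)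
    (c : config G) : u != v ->
  \sum_w F w (c w) =
  F u (c u) + (F v (c v) + \sum_(w | (w != u) && (w != v)) F w (c w)).
Proof. by move=> uv; rewrite (bigD1 u) //= (bigD1 v) //= eq_sym. Qed.

Lemma sum_move_along (G : cgraph) (F : G -> nat -> nat) (u v : G)
    (c : config G) : u != v ->
  \sum_w F w (move_along u v c w) =
  F u (c u - 2) +
  (F v (c v + 1) + \sum_(w | (w != u) && (w != v)) F w (c w)).
Proof.
move=> uv; rewrite (sum_config_split _ _ uv) !ffunE !eqxx eq_sym (negPf uv).
congr (_ + (_ + _)); apply: eq_bigr => w /andP[wu wv].
by rewrite ffunE (negPf wu) (negPf wv).
Qed.

Definition rooted_weight (G : cgraph) (r : G) (c : config G) : nat :=
  \sum_v (if v == r then 1 else 2) * c v.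

(** The two pebbles removed weigh at least 2 together, and the one added weighs at most 2. *)
Lemma rooted_weight_move (G : cgraph) (r : G) (c c' : config G) :
  pebbling_move c c' -> rooted_weight r c' <= rooted_weight r c.
Proof.
move=> [u [v [uv cu ->]]].
have {}uv : u != v by apply: contraTneq uv => ->; rewrite adj_irr.
pose F (w : G) x := (if w == r then 1 else 2) * x.
rewrite /rooted_weight (sum_move_along F c uv) (sum_config_split F c uv) /F.
by rewrite !addnA leq_add2r; case: (u == r); case: (v == r); lia.
Qed.

Lemma rooted_weight_moves (G : cgraph) (r : G) (c c' : config G) :
  clos_refl_trans (config G) (@pebbling_move G) c c' ->
  rooted_weight r c' <= rooted_weight r c.
Proof.
elim=> [{}c {}c' /rooted_weight_move //|//|c1 c2 c3 _ le21 _ le32].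
exact: leq_trans le32 le21.
Qed.

Definition stacked (G : cgraph) (r : G) (k : nat) : config G :=
  [ffun v => if v == r then k else 0].

Lemma size_stacked (G : cgraph) (r : G) (k : nat) :
  config_size (stacked r k) = k.
Proof.
rewrite /config_size (bigD1 r) //= ffunE eqxx big1 ?addn0 // => v vr.
by rewrite ffunE (negPf vr).
Qed.

Lemma rooted_weight_stacked (G : cgraph) (r : G) (k : nat) :
  rooted_weight r (stacked r k) = k.
Proof.
rewrite /rooted_weight (bigD1 r) //= ffunE eqxx mul1n big1 ?addn0 // => v vr.
by rewrite ffunE (negPf vr) muln0.
Qed.

Lemma rooted_weight_cover (G : cgraph) (r : G) (c : config G) :
  (forall v, 1 <= c v) -> 2 * #|G| - 1 <= rooted_weight r c.
Proof.
move=> c_gt0.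
have -> : 2 * #|G| - 1 = \sum_(v : G) (if v == r then 1 else 2).
  rewrite mulnC -sum_nat_const (bigD1 r) //= [RHS](bigD1 r) //= eqxx.
  by rewrite -addnBAC // subn1; congr (_ + _); apply: eq_bigr => v /negPf->.
by apply: leq_sum => v _; rewrite leq_pmulr.
Qed.

Lemma always_cover_solvable_ge (G : cgraph) (r : G) (k : nat) :
  always_cover_solvable G k -> 2 * #|G| - 1 <= k.
Proof.
move=> /(_ _ (size_stacked r k)) [c [moves c_gt0]].
rewrite -[k in leqRHS](rooted_weight_stacked r).
exact: leq_trans (rooted_weight_cover r c_gt0) (rooted_weight_moves r moves).
Qed.

Definition empty_count (G : cgraph) (c : config G) : nat :=
  \sum_v (c v == 0).

(* Truncated subtraction makes an empty vertex contribute 0. *)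
Definition spare_moves (G : cgraph) (c : config G) : nat :=
  \sum_v (c v - 1)./2.

(** The bound holds vertex by vertex: it is an equality where [c v] is even, zero included, and has
    slack 1 where [c v] is odd. *)
Lemma size_le_spare_moves (G : cgraph) (c : config G) :
  config_size c + 2 * empty_count c <= 2 * spare_moves c + 2 * #|G|.
Proof.
rewrite /config_size /empty_count /spare_moves (mulnC 2 #|G|) -sum_nat_const.
rewrite !big_distrr -!big_split /=; apply: leq_sum => v _.
by case: eqP; lia.
Qed.

Lemma complete_cover_solvable (n : nat) (c : config (complete_graph n)) :
  empty_count c <= spare_moves c -> cover_solvable c.
Proof.
(* Induction on the number of empty vertices, for all configurations at once. *)
move: {2}(empty_count c) (erefl (empty_count c)) => z.
elim: z c => [|z IHz] c cz c_spare.
  exists c; split=> [|v]; first exact: rt_refl.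
  by move/eqP: cz; rewrite sum_nat_eq0 => /forallP/(_ v); case: (c v).
have [v v0] : exists v, c v == 0.
  apply/existsP; apply: contraTT isT => /existsPn c_gt0.
  by move: cz; rewrite /empty_count big1 // => v _; rewrite (negPf (c_gt0 v)).
(* Some spare move exists, so some vertex has three pebbles and stays covered after giving up
   two. *)
have [u u3] : exists u, 2 < c u.
  apply/existsP; apply: contraTT isT => /existsPn c_le2.
  move: c_spare; rewrite cz /spare_moves big1 // => u _.
  by have := c_le2 u; lia.
have uv : u != v by apply: contraTneq u3 => ->; rewrite (eqP v0).
pose c' := move_along u v c.
have c'z : empty_count c' = z.
  pose F (_ : complete_graph n) x := nat_of_bool (x == 0).
  move: cz; rewrite /empty_count (sum_move_along F c uv).
  rewrite (sum_config_split F c uv) /F v0; set s := \sum_(_ | _) _.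
  by move: s => s; lia.
(* Only [u] loses a spare move; [v] has none with 0 pebbles or with 1. *)
have c'_spare : (spare_moves c').+1 = spare_moves c.
  pose F (_ : complete_graph n) x := (x - 1)./2.
  rewrite /spare_moves (sum_move_along F c uv) (sum_config_split F c uv) /F.
  rewrite (eqP v0) /=; set s := \sum_(_ | _) _.
  by move: (c u) s u3 => x s; clear; lia.
have [|d [moves d_gt0]] := IHz c' c'z; first by lia.
exists d; split=> //; apply: rt_trans moves; apply: rt_step.
by exists u, v; split=> //; exact: ltnW.
Qed.

Theorem theorem1 (n : nat) (hn : 1 <= n) :
  is_cover_pebbling_number (complete_graph n) (2 * n - 1).
Proof.
have cardG : #|complete_graph n| = n by rewrite card_ord.
split=> [c c_size | k].
  apply: complete_cover_solvable.
  (* With size 2n - 1 the bound reads 2e <= 2s + 1 for e empty vertices and s spare moves, so e <= s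
     by parity. *)
  by have := size_le_spare_moves c; rewrite c_size cardG; lia.
rewrite -[in 2 * n]cardG.
exact: (@always_cover_solvable_ge (complete_graph n) (Ordinal hn)).
Qed.
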